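(* Let $\alpha\in[0,1)$ and let $h(z)=z+a_2z^2+\cdots$ be analytic in $\mathbb{D}=\{|z|<1\}$ and convex of order $\alpha$. Let $u(z)=h(z)+\frac{1}{2}(1-|z|^{2})\,zh'(z)$ for $z\in\mathbb{D}$. Then $u$ is univalent in $\mathbb{D}$ if $\alpha\ge 1/2$, and if $\alpha\in[0,1/2)$ then $u$ is univalent in the subdisk $|z|<r$, where $$r=\frac{-(1-\alpha)+\sqrt{(1-\alpha)^2+1-2\alpha}}{1-2\alpha}.$$
   Context: For $\alpha\in[-1/2,1)$, a locally univalent analytic function $h(z)=z+a_2z^2+\cdots$ in $\mathbb{D}$ is convex of order $\alpha$ if $\operatorname{Re}\big(1+zh''(z)/h'(z)\big)>\alpha$ for all $z\in\mathbb{D}$. *)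

(* Defs.v *)
From Stdlib Require Import Reals.
From Coquelicot Require Import Coquelicot.

Open Scope R_scope.

Definition in_disk (r : R) (z : C) : Prop := Cmod z < r.
Definition unit_disk (z : C) : Prop := in_disk 1 z.

Definition has_cderiv_on_disk (f f' : C -> C) : Prop :=
  forall z : C, unit_disk z -> is_derive (K := C_AbsRing) (V := C_NormedModule) f z (f' z).

(* h analytic in D, normalized h(z) = z + a_2 z^2 + ..., i.e. h(0) = 0 and h'(0) = 1,
   with first and second derivatives h1, h2 on D. *)
Definition normalized_analytic (h h1 h2 : C -> C) : Prop :=
  has_cderiv_on_disk h h1 /\ has_cderiv_on_disk h1 h2 /\
  h (RtoC 0) = RtoC 0 /\ h1 (RtoC 0) = RtoC 1.

Definition convex_of_order (alpha : R) (h1 h2 : C -> C) : Prop :=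
  (forall z : C, unit_disk z -> h1 z <> RtoC 0) /\
  (forall z : C, unit_disk z ->
     Re (Cplus (RtoC 1) (Cdiv (Cmult z (h2 z)) (h1 z))) > alpha).

Definition u_of (h h1 : C -> C) (z : C) : C :=
  Cplus (h z) (Cmult (RtoC ((1 / 2) * (1 - (Cmod z) ^ 2))) (Cmult z (h1 z))).

Definition univalent_on (S : C -> Prop) (f : C -> C) : Prop :=
  forall z w : C, S z -> S w -> f z = f w -> z = w.

Definition radius_r (alpha : R) : R :=
  (- (1 - alpha) + sqrt ((1 - alpha) ^ 2 + 1 - 2 * alpha)) / (1 - 2 * alpha).

(* Main.v *)
Require Import Defs.
From Stdlib Require Import Reals Lra Lia Classical IndefiniteDescription.
From Coquelicot Require Import Coquelicot.
Open Scope R_scope.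

(** Let [c = h z1 - h z0].  The segment from [h z0] to [h z1] lifts through [h] to a curve
    [g] in the disk with [g' = c / h1 g].  Put [p = Re (conj c * g * h1 g)].  Then
    [|g|^2] has derivative [2 p / |h1 g|^2], and [p' = |c|^2 Re (1 + g h2 g / h1 g) >= 0].
    Hence the derivative of [|g|^2] changes sign at most once, from negative to positive,
    so [|g|] never exceeds the larger of its end values; this a priori bound is what
    allows the lift to be continued while its end point moves along the segment from [z0]
    to [z1].  Finally [Re (conj c * u g)] has derivative
    [|c|^2 + ((1 - |g|^2) p' - 2 p^2 / |h1 g|^2) / 2], which is at least
    [|c|^2 (1 - |g|^2) > 0] because [p^2 <= |c|^2 |g|^2 |h1 g|^2]; therefore
    [u z0 <> u z1].  When [c = 0] the lift is constant and [z0 = z1].  This settles the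
    whole unit disk for every [alpha >= 0], and [radius_r alpha <= 1]. *)

Lemma im_le_Cmod (z : C) : Rabs (Im z) <= Cmod z.
Proof. eapply Rle_trans; [apply Rmax_r | apply Rmax_Cmod]. Qed.

Lemma Cmod_le_re_im (z : C) : Cmod z <= Rabs (Re z) + Rabs (Im z).
Proof.
replace z with (RtoC (Re z) + Ci * RtoC (Im z))%C at 1.
- eapply Rle_trans; [apply Cmod_triangle|].
  rewrite Cmod_mult, !Cmod_R, Cmod_Ci; lra.
- destruct z as [x y]; unfold Ci, RtoC, Cplus, Cmult; simpl; f_equal; ring.
Qed.

Lemma Cmod_minus_sym (z w : C) : Cmod (z - w)%C = Cmod (w - z)%C.
Proof. rewrite <- Cmod_opp; f_equal; ring. Qed.

Lemma Cmod_minus_triangle (x y z : C) :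
  Cmod (x - z)%C <= Cmod (x - y)%C + Cmod (y - z)%C.
Proof.
replace (x - z)%C with ((x - y) + (y - z))%C by ring; apply Cmod_triangle.
Qed.

Lemma Cmod_le_plus_minus (x y : C) : Cmod x <= Cmod y + Cmod (x - y)%C.
Proof.
replace x with (y + (x - y))%C at 1 by ring; apply Cmod_triangle.
Qed.

Lemma Cmod_minus_diag (z : C) : Cmod (z - z)%C = 0.
Proof. rewrite <- Cmod_0; f_equal; ring. Qed.

Lemma Cmod_minus_eq_0 (z w : C) : Cmod (z - w)%C = 0 -> z = w.
Proof. intros H; apply Ceq_minus, Cmod_eq_0, H. Qed.

Lemma re_conj_mult_self (z : C) : Re (Cconj z * z)%C = Cmod z ^ 2.
Proof.
rewrite re_mult, re_conj, im_conj, Cmod2_alt; ring.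
Qed.

Lemma continuous_C_ball {U : UniformSpace} (g : U -> C) (x : U) :
  continuous g x <-> forall eps : posreal, locally x (fun y => Cmod (g y - g x)%C < eps).
Proof.
unfold continuous; rewrite (filterlim_locally_ball_norm (U := C_R_NormedModule)).
split; intros Hg eps; generalize (Hg eps); apply filter_imp; intros y;
  unfold ball_norm; now rewrite <- Cmod_norm.
Qed.

Lemma locally_C_ball (z : C) (P : C -> Prop) :
  locally z P <-> exists r : posreal, forall w, Cmod (w - z)%C < r -> P w.
Proof.
split.
- intros HP; destruct (locally_norm_le_locally (V := C_R_NormedModule) z P HP) as [r Hr].
  exists r; intros w Hw; apply Hr; unfold ball_norm; now rewrite <- Cmod_norm.
- intros [r Hr]; generalize (locally_ball_norm (V := C_R_NormedModule) z r).
  apply filter_imp; unfold ball_norm; intros w; rewrite <- Cmod_norm; exact (Hr w).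
Qed.

Lemma locally_in_disk (r : R) (z : C) : in_disk r z -> locally z (in_disk r).
Proof.
unfold in_disk; intros Hz; assert (gap_gt0 : 0 < r - Cmod z) by lra.
apply locally_C_ball; exists (mkposreal _ gap_gt0); cbn; intros w Hw.
pose proof (Cmod_le_plus_minus w z); lra.
Qed.

(** * Complex derivatives along real curves *)

Lemma is_derive_C_remainder (f : C -> C) (z k : C) (eps : posreal) :
  is_derive f z k ->
  locally z (fun w => Cmod (f w - f z - (w - z) * k)%C <= eps * Cmod (w - z)%C).
Proof.
intros [_ Hf]; apply locally_C; exact (Hf z (fun P HP => HP) eps).
Qed.

Lemma is_derive_curve_remainder (g : R -> C) (t : R) (l : C) :
  is_derive g t l <->
  forall eps : posreal,
    locally t (fun s => Cmod (g s - g t - RtoC (s - t) * l)%C <= eps * Rabs (s - t)).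
Proof.
split.
- intros [_ Hg] eps; generalize (Hg t (fun P HP => HP) eps); apply filter_imp; intros s.
  now rewrite <- Cmod_norm, scal_R_Cmult.
- intros Hg; split; [apply is_linear_scal_l|].
  intros x Hx eps; rewrite <- (is_filter_lim_locally_unique _ _ Hx).
  generalize (Hg eps); apply filter_imp; intros s.
  now rewrite <- Cmod_norm, scal_R_Cmult.
Qed.

Lemma is_derive_C_id (z : C) : is_derive (fun w : C => w) z (RtoC 1).
Proof.
destruct (is_derive_id (K := C_AbsRing) z) as [_ id_domin]; split; [|exact id_domin].
apply (is_linear_scal_l (V := C_NormedModule)).
Qed.

Lemma is_derive_C_mult (f g : C -> C) (z k l : C) :
  is_derive f z k -> is_derive g z l ->
  is_derive (fun w => f w * g w)%C z (k * g z + f z * l)%C.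
Proof.
intros [_ f_domin] Hg; eapply filterdiff_ext_lin.
- apply (filterdiff_scal_fct (U := AbsRing_NormedModule C_AbsRing)
    (V := C_NormedModule) z f g (fun y => y * k)%C).
  + exact Cmult_comm.
  + split; [|exact f_domin].
    apply (is_linear_scal_l (V := AbsRing_NormedModule C_AbsRing) k).
  + exact Hg.
- intros y; change (y * k * g z + f z * (y * l) = y * (k * g z + f z * l))%C; ring.
Qed.

Lemma is_derive_C_minus_scal (f : C -> C) (z k l : C) :
  is_derive f z k -> is_derive (fun w => f w - w * l)%C z (k - l)%C.
Proof.
intros Hf; replace (k - l)%C with (k - 1 * l)%C by ring.
apply (is_derive_minus (V := C_NormedModule) f (fun w => w * l)%C); [exact Hf|].
apply (is_derive_scal_l (V := C_NormedModule) (fun w : C_AbsRing => w)).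
apply (is_derive_id (K := C_AbsRing)).
Qed.

Lemma is_derive_C_filterdiff_R (f : C -> C) (z k : C) :
  is_derive f z k ->
  filterdiff (U := C_R_NormedModule) (V := C_R_NormedModule)
    f (locally z) (fun w => w * k)%C.
Proof.
intros Hf; split.
- split.
  + intros x y; apply Cmult_plus_distr_r.
  + intros a x; rewrite !scal_R_Cmult; apply eq_sym, Cmult_assoc.
  + exists (Cmod k + 1); pose proof (Cmod_ge_0 k); split; [lra|]; intros x.
    rewrite <- !Cmod_norm, Cmod_mult; pose proof (Cmod_ge_0 x); nra.
- intros x Hx eps; rewrite <- (is_filter_lim_locally_unique _ _ Hx).
  generalize (is_derive_C_remainder f z k eps Hf); apply filter_imp; intros w.
  now rewrite <- !Cmod_norm.
Qed.

Lemma is_derive_C_continuous (f : C -> C) (z k : C) :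
  is_derive f z k -> continuous f z.
Proof.
intros Hf.
apply (filterdiff_continuous (U := C_R_NormedModule) (V := C_R_NormedModule)).
eexists; exact (is_derive_C_filterdiff_R f z k Hf).
Qed.

Lemma is_derive_comp_C (f : C -> C) (g : R -> C) (t : R) (k l : C) :
  is_derive f (g t) k -> is_derive g t l -> is_derive (fun s => f (g s)) t (l * k)%C.
Proof.
intros Hf%is_derive_C_filterdiff_R Hg; eapply filterdiff_ext_lin.
- exact (filterdiff_comp' g f t _ _ Hg Hf).
- intros y; rewrite !scal_R_Cmult; apply eq_sym, Cmult_assoc.
Qed.

Lemma lipschitz_at_of_comp_C (f : C -> C) (g : R -> C) (t : R) (k l : C) :
  continuous g t -> is_derive f (g t) k -> k <> 0 ->
  is_derive (fun s => f (g s)) t l ->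
  exists M, 0 < M /\ locally t (fun s => Cmod (g s - g t)%C <= M * Rabs (s - t)).
Proof.
intros g_cont f_deriv k_neq0 fg_deriv.
assert (k_gt0 : 0 < Cmod k) by now apply Cmod_gt_0.
pose proof (Cmod_ge_0 l) as l_ge0.
assert (half_k_gt0 : 0 < Cmod k / 2) by lra.
assert (f_near : locally t (fun s =>
  Cmod (f (g s) - f (g t) - (g s - g t) * k)%C <= Cmod k / 2 * Cmod (g s - g t)%C))
  by exact (g_cont _ (is_derive_C_remainder f _ k (mkposreal _ half_k_gt0) f_deriv)).
pose proof (proj1 (is_derive_curve_remainder _ t l) fg_deriv (mkposreal 1 Rlt_0_1))
  as fg_near.
exists (2 * (Cmod l + 1) / Cmod k); split; [apply Rdiv_lt_0_compat; lra|].
generalize (filter_and _ _ f_near fg_near); apply filter_imp; cbn; intros s [Hf Hfg].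
pose proof (Cmod_le_plus_minus ((g s - g t) * k) (f (g s) - f (g t))) as lower.
pose proof (Cmod_le_plus_minus (f (g s) - f (g t)) (RtoC (s - t) * l)) as upper.
rewrite (Cmod_minus_sym ((g s - g t) * k)), Cmod_mult in lower.
rewrite Cmod_mult, Cmod_R in upper.
apply Rmult_le_reg_l with (Cmod k / 2); [exact half_k_gt0|].
replace (Cmod k / 2 * (2 * (Cmod l + 1) / Cmod k * Rabs (s - t)))
  with ((Cmod l + 1) * Rabs (s - t)) by (field; lra).
lra.
Qed.

Lemma is_derive_of_comp_C (f : C -> C) (g : R -> C) (t : R) (k l : C) :
  continuous g t -> is_derive f (g t) k -> k <> 0 ->
  is_derive (fun s => f (g s)) t l -> is_derive g t (l / k)%C.
Proof.
intros g_cont f_deriv k_neq0 fg_deriv; apply is_derive_curve_remainder; intros eps.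
destruct (lipschitz_at_of_comp_C f g t k l) as [M [M_gt0 g_lip]]; trivial.
assert (k_gt0 : 0 < Cmod k) by now apply Cmod_gt_0.
assert (half_gt0 : 0 < eps * Cmod k / 2) by (pose proof (cond_pos eps); nra).
assert (halfM_gt0 : 0 < eps * Cmod k / 2 / M) by now apply Rdiv_lt_0_compat.
assert (f_near : locally t (fun s =>
  Cmod (f (g s) - f (g t) - (g s - g t) * k)%C
  <= eps * Cmod k / 2 / M * Cmod (g s - g t)%C))
  by exact (g_cont _ (is_derive_C_remainder f _ k (mkposreal _ halfM_gt0) f_deriv)).
pose proof (proj1 (is_derive_curve_remainder _ t l) fg_deriv (mkposreal _ half_gt0))
  as fg_near.
generalize (filter_and _ _ g_lip (filter_and _ _ f_near fg_near)).
apply filter_imp; cbn; intros s [Hg [Hf Hfg]].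
apply Rmult_le_reg_l with (Cmod k); [exact k_gt0|].
rewrite <- Cmod_mult.
replace (k * (g s - g t - RtoC (s - t) * (l / k)))%C
  with ((f (g s) - f (g t) - RtoC (s - t) * l)
        - (f (g s) - f (g t) - (g s - g t) * k))%C by (field; exact k_neq0).
unfold Cminus at 1; eapply Rle_trans; [apply Cmod_triangle|]; rewrite Cmod_opp.
apply Rmult_le_compat_l with (r := eps * Cmod k / 2 / M) in Hg; [|lra].
replace (eps * Cmod k / 2 / M * (M * Rabs (s - t)))
  with (eps * Cmod k / 2 * Rabs (s - t)) in Hg by (field; lra).
lra.
Qed.

Lemma is_linear_re_mult (a : C) :
  is_linear (U := C_R_NormedModule) (V := R_NormedModule) (fun z => Re (a * z)%C).
Proof.
split.
- intros x y; now rewrite <- re_plus, <- Cmult_plus_distr_l.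
- intros b x; rewrite scal_R_Cmult.
  replace (a * (RtoC b * x))%C with (RtoC b * (a * x))%C by ring; apply re_scal_l.
- exists (Cmod a + 1); pose proof (Cmod_ge_0 a); split; [lra|]; intros x.
  rewrite <- Cmod_norm; eapply Rle_trans; [apply re_le_Cmod|].
  rewrite Cmod_mult; pose proof (Cmod_ge_0 x); nra.
Qed.

Lemma is_derive_re_mult (a : C) (g : R -> C) (t : R) (l : C) :
  is_derive g t l -> is_derive (fun s => Re (a * g s)%C) t (Re (a * l)%C).
Proof.
intros Hg; eapply filterdiff_ext_lin.
- apply (filterdiff_comp' g (fun z => Re (a * z)%C) t _ (fun z => Re (a * z)%C) Hg).
  apply filterdiff_linear, is_linear_re_mult.
- intros y; exact (linear_scal _ (is_linear_re_mult a) y l).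
Qed.

Lemma continuous_re_mult (a : C) (g : R -> C) (t : R) :
  continuous g t -> continuous (fun s => Re (a * g s)%C) t.
Proof.
intros Hg; apply (continuous_comp g (fun z => Re (a * z)%C)); [exact Hg|].
apply (filterdiff_continuous (U := C_R_NormedModule) (V := R_NormedModule)).
eexists; apply filterdiff_linear, is_linear_re_mult.
Qed.

Lemma filterdiff_Cmod_sqr (z : C) :
  filterdiff (U := C_R_NormedModule) (V := R_NormedModule)
    (fun w => Cmod w ^ 2) (locally z) (fun w => Re (2 * Cconj z * w)%C).
Proof.
split; [apply is_linear_re_mult|].
intros x Hx eps; rewrite <- (is_filter_lim_locally_unique _ _ Hx).
apply locally_C_ball; exists eps; intros w Hw; rewrite <- Cmod_norm.
change (Rabs (Cmod w ^ 2 - Cmod z ^ 2 - Re (2 * Cconj z * (w - z))%C)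
        <= eps * Cmod (w - z)%C).
replace (Cmod w ^ 2 - Cmod z ^ 2 - Re (2 * Cconj z * (w - z))%C)
  with (Cmod (w - z)%C ^ 2).
- pose proof (Cmod_ge_0 (w - z)%C); rewrite Rabs_pos_eq by nra; nra.
- rewrite !Cmod2_alt; destruct z, w; unfold Re, Im, Cconj, RtoC; simpl; ring.
Qed.

Lemma is_derive_Cmod_sqr (g : R -> C) (t : R) (l : C) :
  is_derive g t l ->
  is_derive (fun s => Cmod (g s) ^ 2) t (2 * Re (Cconj (g t) * l)%C).
Proof.
intros Hg; eapply filterdiff_ext_lin.
- exact (filterdiff_comp' g (fun z => Cmod z ^ 2) t _ _ Hg (filterdiff_Cmod_sqr (g t))).
- intros y; rewrite <- re_scal_l, scal_R_Cmult.
  replace (2 * Cconj (g t) * (RtoC y * l))%C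
    with (RtoC y * (2 * (Cconj (g t) * l)))%C by ring.
  apply re_scal_l.
Qed.

Lemma continuous_Cmod_sqr (g : R -> C) (t : R) :
  continuous g t -> continuous (fun s => Cmod (g s) ^ 2) t.
Proof.
intros Hg; apply (continuous_comp g (fun z => Cmod z ^ 2)); [exact Hg|].
apply (filterdiff_continuous (U := C_R_NormedModule) (V := R_NormedModule)).
eexists; apply filterdiff_Cmod_sqr.
Qed.

(** * Mean value theorems *)

Lemma MVT_is_derive (f df : R -> R) (a b : R) :
  a < b ->
  (forall t, a < t < b -> is_derive f t (df t)) ->
  (forall t, a <= t <= b -> continuous f t) ->
  exists t, a < t < b /\ f b - f a = df t * (b - a).
Proof.
intros Hab f_deriv f_cont.
assert (f_derivable : forall t, a < t < b -> derivable_pt f t).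
{ intros t Ht; exists (df t); now apply is_derive_Reals, f_deriv. }
destruct (MVT f id a b f_derivable (fun t _ => derivable_pt_id t) Hab) as [t [Ht E]].
- intros t Ht; now apply continuity_pt_filterlim, f_cont.
- intros t _; apply derivable_continuous_pt, derivable_pt_id.
- exists t; split; [exact Ht|].
  rewrite derive_pt_id, (derive_pt_eq_0 f t (df t)) in E
    by now apply is_derive_Reals, f_deriv.
  unfold id in E; lra.
Qed.

Lemma le_Rmax_of_derive_sign (f df : R -> R) (a b : R) :
  (forall t, a < t < b -> is_derive f t (df t)) ->
  (forall t, a <= t <= b -> continuous f t) ->
  (forall s t, a < s -> s <= t -> t < b -> 0 < df s -> 0 <= df t) ->
  forall t, a <= t <= b -> f t <= Rmax (f a) (f b).
Proof.
intros f_deriv f_cont df_sign t Ht; apply Rnot_lt_le; intros Hlt.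
pose proof (Rmax_l (f a) (f b)); pose proof (Rmax_r (f a) (f b)).
assert (Ht' : a < t < b) by (destruct Ht as [[A | A] [B | B]]; subst; lra).
destruct (MVT_is_derive f df a t) as [rise [Hrise f_rises]];
  [lra | intros; apply f_deriv; lra | intros; apply f_cont; lra |].
destruct (MVT_is_derive f df t b) as [fall [Hfall f_falls]];
  [lra | intros; apply f_deriv; lra | intros; apply f_cont; lra |].
assert (df_rise : 0 < df rise) by nra.
assert (df_fall : 0 <= df fall) by (apply (df_sign rise); lra).
nra.
Qed.

Lemma Cmod_increment_le (g dg : R -> C) (a b M : R) :
  a < b ->
  (forall t, a < t < b -> is_derive g t (dg t)) ->
  (forall t, a <= t <= b -> continuous g t) ->
  (forall t, a < t < b -> Cmod (dg t) <= M) ->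
  Cmod (g b - g a)%C <= M * (b - a).
Proof.
intros Hab g_deriv g_cont dg_le.
set (E := (g b - g a)%C).
destruct (MVT_is_derive (fun t => Re (Cconj E * g t)%C)
  (fun t => Re (Cconj E * dg t)%C) a b Hab) as [t [Ht mean]].
- intros t Ht; now apply is_derive_re_mult, g_deriv.
- intros t Ht; now apply continuous_re_mult, g_cont.
- assert (sqr_E : Re (Cconj E * g b)%C - Re (Cconj E * g a)%C = Cmod E ^ 2).
  { rewrite <- re_conj_mult_self.
    change (Re ?x - Re ?y) with (Re (x - y)%C); unfold E; f_equal; ring. }
  rewrite sqr_E in mean.
  pose proof (Rle_abs (Re (Cconj E * dg t)%C)) as abs_le.
  pose proof (re_le_Cmod (Cconj E * dg t)%C) as mod_le.
  rewrite Cmod_mult, Cmod_conj in mod_le.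
  specialize (dg_le t Ht); pose proof (Cmod_ge_0 (dg t)).
  destruct (Cmod_ge_0 E) as [E_gt0 | E_eq0]; [|rewrite <- E_eq0; nra].
  apply Rmult_le_reg_l with (Cmod E); [exact E_gt0|].
  replace (Cmod E * Cmod E) with (Re (Cconj E * dg t)%C * (b - a)) by lra.
  rewrite <- Rmult_assoc; apply Rmult_le_compat_r; nra.
Qed.

(** * Segments and the unit interval *)

Definition segment (a b : C) (t : R) : C := (a + RtoC t * (b - a))%C.

Lemma segment_0 (a b : C) : segment a b 0 = a.
Proof. unfold segment; ring. Qed.

Lemma segment_1 (a b : C) : segment a b 1 = b.
Proof. unfold segment; ring. Qed.

Lemma segment_diag (a : C) (t : R) : segment a a t = a.
Proof. unfold segment; ring. Qed.

Lemma segment_translate (a b p : C) (t : R) :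
  (segment a b t - p)%C = segment (a - p)%C (b - p)%C t.
Proof. unfold segment; ring. Qed.

Lemma segment_minus_param (a b : C) (s t : R) :
  (segment a b s - segment a b t)%C = (RtoC (s - t) * (b - a))%C.
Proof. unfold segment; rewrite RtoC_minus; ring. Qed.

Lemma segment_minus_end (a b b' : C) (t : R) :
  (segment a b' t - segment a b t)%C = (RtoC t * (b' - b))%C.
Proof. unfold segment; ring. Qed.

Lemma is_derive_segment (a b : C) (t : R) : is_derive (segment a b) t (b - a)%C.
Proof.
apply is_derive_curve_remainder; intros eps; apply filter_forall; intros s.
rewrite segment_minus_param, Cmod_minus_diag.
pose proof (cond_pos eps); pose proof (Rabs_pos (s - t)); nra.
Qed.

Lemma continuous_segment (a b : C) (t : R) : continuous (segment a b) t.
Proof.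
apply (ex_derive_continuous (V := C_R_NormedModule)).
eexists; apply is_derive_segment.
Qed.

Lemma Cmod_segment_le (a b : C) (r t : R) :
  0 <= t <= 1 -> Cmod a <= r -> Cmod b <= r -> Cmod (segment a b t) <= r.
Proof.
intros Ht Ha Hb.
replace (segment a b t) with (RtoC (1 - t) * a + RtoC t * b)%C
  by (unfold segment; rewrite RtoC_minus; ring).
eapply Rle_trans; [apply Cmod_triangle|].
rewrite !Cmod_mult, !Cmod_R, !Rabs_pos_eq by lra; nra.
Qed.

Definition clamp (t : R) : R := Rmax 0 (Rmin 1 t).

Lemma clamp_range (t : R) : 0 <= clamp t <= 1.
Proof. unfold clamp, Rmax, Rmin; repeat destruct Rle_dec; lra. Qed.

Lemma clamp_id (t : R) : 0 <= t <= 1 -> clamp t = t.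
Proof. unfold clamp, Rmax, Rmin; repeat destruct Rle_dec; lra. Qed.

Lemma clamp_ge1 (t : R) : 1 <= t -> clamp t = 1.
Proof. unfold clamp, Rmax, Rmin; repeat destruct Rle_dec; lra. Qed.

Lemma clamp_lipschitz (s t : R) : Rabs (clamp s - clamp t) <= Rabs (s - t).
Proof.
unfold clamp, Rmax, Rmin; repeat destruct Rle_dec; unfold Rabs;
  repeat destruct Rcase_abs; lra.
Qed.

Lemma continuous_clamp (t : R) : continuous clamp t.
Proof.
apply filterlim_locally; intros eps; exists eps; intros s Hs.
eapply Rle_lt_trans; [apply clamp_lipschitz | exact Hs].
Qed.

Lemma unit_interval_step_ind (P : R -> Prop) (e : R) :
  0 < e -> P 0 ->
  (forall s t, 0 <= s <= 1 -> 0 <= t <= 1 -> Rabs (t - s) <= e -> P s -> P t) ->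
  P 1.
Proof.
intros e_gt0 P0 P_step.
assert (P_iter : forall n, P (clamp (INR n * e))).
{ induction n as [|n IH].
  - cbn; rewrite Rmult_0_l, clamp_id; [exact P0 | lra].
  - apply (P_step (clamp (INR n * e))); try apply clamp_range; [|exact IH].
    eapply Rle_trans; [apply clamp_lipschitz|].
    rewrite S_INR, Rabs_pos_eq; lra. }
destruct (nfloor_ex (/ e)) as [n [_ Hn]].
{ left; now apply Rinv_0_lt_compat. }
rewrite <- (clamp_ge1 (INR (S n) * e)); [apply P_iter|].
apply Rmult_lt_compat_r with (r := e) in Hn; [|exact e_gt0].
rewrite Rinv_l in Hn by lra; rewrite S_INR; lra.
Qed.

(** * Local inversion at a uniform scale *)

Definition approx_linear_on (f : C -> C) (p : C) (r : R) (k : C) (eps : R) : Prop :=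
  forall z w, Cmod (z - p)%C <= r -> Cmod (w - p)%C <= r ->
  Cmod (f z - f w - (z - w) * k)%C <= eps * Cmod (z - w)%C.

Lemma approx_linear_on_ball (f f' : C -> C) (p k : C) (r eps : R) :
  (forall a, Cmod (a - p)%C <= r -> is_derive f a (f' a) /\ Cmod (f' a - k)%C <= eps) ->
  approx_linear_on f p r k eps.
Proof.
intros Hf z w Hz Hw.
assert (in_ball : forall t, 0 <= t <= 1 -> Cmod (segment w z t - p)%C <= r)
  by (intros t Ht; rewrite segment_translate; now apply Cmod_segment_le).
assert (deriv : forall t, 0 <= t <= 1 ->
  is_derive (fun s => f (segment w z s) - segment w z s * k)%C t
    ((z - w) * (f' (segment w z t) - k))%C).
{ intros t Ht; apply (is_derive_comp_C (fun a => f a - a * k)%C);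
    [now apply is_derive_C_minus_scal, Hf, in_ball | apply is_derive_segment]. }
pose proof (Cmod_increment_le (fun s => f (segment w z s) - segment w z s * k)%C
  (fun t => (z - w) * (f' (segment w z t) - k))%C 0 1 (eps * Cmod (z - w)%C) Rlt_0_1)
  as increment.
cbv beta in increment; rewrite !segment_0, !segment_1 in increment.
replace (f z - f w - (z - w) * k)%C with (f z - z * k - (f w - w * k))%C by ring.
eapply Rle_trans; [apply increment|right; ring].
- intros t Ht; apply deriv; lra.
- intros t Ht; apply (ex_derive_continuous (V := C_R_NormedModule)).
  eexists; now apply deriv.
- intros t Ht; rewrite Cmod_mult, Rmult_comm.
  apply Rmult_le_compat_r; [apply Cmod_ge_0|apply Hf, in_ball; lra].
Qed.

Lemma approx_linear_expanding (f : C -> C) (p k z w : C) (r eps : R) :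
  approx_linear_on f p r k eps -> Cmod (z - p)%C <= r -> Cmod (w - p)%C <= r ->
  (Cmod k - eps) * Cmod (z - w)%C <= Cmod (f z - f w)%C.
Proof.
intros f_approx Hz Hw; specialize (f_approx z w Hz Hw).
pose proof (Cmod_le_plus_minus ((z - w) * k) (f z - f w)) as lower.
rewrite (Cmod_minus_sym ((z - w) * k)), Cmod_mult in lower; lra.
Qed.

Lemma approx_linear_lipschitz (f : C -> C) (p k z w : C) (r eps : R) :
  approx_linear_on f p r k eps -> Cmod (z - p)%C <= r -> Cmod (w - p)%C <= r ->
  Cmod (f z - f w)%C <= (Cmod k + eps) * Cmod (z - w)%C.
Proof.
intros f_approx Hz Hw; specialize (f_approx z w Hz Hw).
pose proof (Cmod_le_plus_minus (f z - f w) ((z - w) * k)) as upper.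
rewrite Cmod_mult in upper; lra.
Qed.

Lemma approx_linear_on_subball (f : C -> C) (p a k : C) (r s eps : R) :
  Cmod (a - p)%C + s <= r ->
  approx_linear_on f p r k eps -> approx_linear_on f a s k eps.
Proof.
intros Has f_approx z w Hz Hw; apply f_approx.
- pose proof (Cmod_minus_triangle z a p); lra.
- pose proof (Cmod_minus_triangle w a p); lra.
Qed.

Definition norm_dist {K : AbsRing} {V : NormedModule K} (x y : V) : R :=
  norm (minus x y).

Lemma norm_dist_ge_0 {K : AbsRing} {V : NormedModule K} (x y : V) :
  0 <= norm_dist x y.
Proof. apply norm_ge_0. Qed.

Lemma norm_dist_diag {K : AbsRing} {V : NormedModule K} (x : V) : norm_dist x x = 0.
Proof. unfold norm_dist; rewrite minus_eq_zero; apply norm_zero. Qed.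

Lemma norm_dist_sym {K : AbsRing} {V : NormedModule K} (x y : V) :
  norm_dist x y = norm_dist y x.
Proof. unfold norm_dist; now rewrite <- opp_minus, norm_opp. Qed.

Lemma norm_dist_triangle {K : AbsRing} {V : NormedModule K} (x y z : V) :
  norm_dist x z <= norm_dist x y + norm_dist y z.
Proof. unfold norm_dist; rewrite (minus_trans y x z); apply norm_triangle. Qed.

Lemma sum_n_minus_telescope {G : AbelianGroup} (x : nat -> G) (n : nat) :
  sum_n (fun k => minus (x (S k)) (x k)) n = minus (x (S n)) (x O).
Proof.
induction n as [|n IH]; [apply sum_O|].
now rewrite sum_Sn, IH, plus_comm, <- minus_trans.
Qed.

Lemma filterlim_eventually_S {T : Type} (x : nat -> T) (F : (T -> Prop) -> Prop) :
  filterlim (fun n => x (S n)) eventually F <-> filterlim x eventually F.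
Proof.
split; intros x_lim P HP; destruct (x_lim P HP) as [N HN].
- exists (S N); intros [|n] Hn; [lia | apply HN; lia].
- exists N; intros n Hn; apply HN; lia.
Qed.

Lemma geometric_increments_converge {K : AbsRing} {V : CompleteNormedModule K}
  (x : nat -> V) (M q : R) :
  0 <= q < 1 -> (forall n, norm_dist (x (S n)) (x n) <= M * q ^ n) ->
  exists L, filterlim x eventually (locally L).
Proof.
intros Hq increments.
destruct (ex_series_le (fun n => minus (x (S n)) (x n)) (fun n => M * q ^ n))
  as [l Hl]; [exact increments | |].
- apply (ex_series_scal_l M (fun n => q ^ n)), ex_series_geom.
  rewrite Rabs_pos_eq; lra.
- exists (plus l (x O)); apply filterlim_eventually_S.
  apply (filterlim_ext (fun n =>
    plus (sum_n (fun k => minus (x (S k)) (x k)) n) (x O))).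
  + intros n; rewrite sum_n_minus_telescope.
    unfold minus; now rewrite <- plus_assoc, plus_opp_l, plus_zero_r.
  + eapply filterlim_comp_2; [exact Hl | apply filterlim_const|].
    exact (filterlim_plus l (x O)).
Qed.

Lemma filterlim_norm_dist {K : AbsRing} {V : NormedModule K} (x : nat -> V) (L : V) :
  filterlim x eventually (locally L) <->
  forall eps : posreal, eventually (fun n => norm_dist (x n) L < eps).
Proof. apply (filterlim_locally_ball_norm x L). Qed.

Lemma norm_dist_lim_le {K : AbsRing} {V : NormedModule K} (x : nat -> V) (L a : V)
  (r : R) :
  filterlim x eventually (locally L) -> (forall n, norm_dist (x n) a <= r) ->
  norm_dist L a <= r.
Proof.
intros x_lim x_le; apply le_epsilon; intros eps Heps.
destruct (proj1 (filterlim_norm_dist x L) x_lim (mkposreal eps Heps)) as [N HN].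
specialize (HN N (le_n N)); cbn in HN; rewrite norm_dist_sym in HN.
pose proof (norm_dist_triangle L (x N) a); specialize (x_le N); lra.
Qed.

Lemma contraction_fixed_point {K : AbsRing} {V : CompleteNormedModule K}
  (T : V -> V) (a : V) (q r : R) :
  0 <= q < 1 ->
  (forall x y, norm_dist x a <= r -> norm_dist y a <= r ->
     norm_dist (T x) (T y) <= q * norm_dist x y) ->
  norm_dist (T a) a <= (1 - q) * r ->
  exists x, norm_dist x a <= r /\ T x = x.
Proof.
intros Hq contr start.
assert (r_ge0 : 0 <= r) by (pose proof (norm_dist_ge_0 (T a) a); nra).
set (x := fun n => Nat.iter n T a).
assert (radius_le : forall n, (1 - q ^ n) * r <= r)
  by (intros n; pose proof (pow_le q n (proj1 Hq)); nra).
assert (orbit : forall n, norm_dist (x n) a <= (1 - q ^ n) * r /\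
  norm_dist (x (S n)) (x n) <= (1 - q) * r * q ^ n).
{ induction n as [|n [IHa IHstep]].
  - change (x 0%nat) with a; change (x 1%nat) with (T a).
    rewrite norm_dist_diag; simpl; lra.
  - assert (in_ball : norm_dist (x (S n)) a <= (1 - q ^ S n) * r)
      by (pose proof (norm_dist_triangle (x (S n)) (x n) a); simpl pow; lra).
    split; [exact in_ball|].
    pose proof (radius_le n); pose proof (radius_le (S n)).
    pose proof (contr (x (S n)) (x n) ltac:(lra) ltac:(lra)) as step.
    change (T (x (S n))) with (x (S (S n))) in step.
    change (T (x n)) with (x (S n)) in step; simpl pow; nra. }
assert (in_ball : forall n, norm_dist (x n) a <= r).
{ intros n; destruct (orbit n); pose proof (radius_le n); lra. }
destruct (geometric_increments_converge x ((1 - q) * r) q Hq) as [L HL];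
  [apply orbit|].
assert (L_in_ball : norm_dist L a <= r) by exact (norm_dist_lim_le x L a r HL in_ball).
exists L; split; [exact L_in_ball|].
apply (filterlim_locally_unique (F := eventually) (fun n => x (S n)));
  [|now apply filterlim_eventually_S].
apply filterlim_norm_dist; intros eps.
generalize (proj1 (filterlim_norm_dist x L) HL eps); apply filter_imp; intros n Hn.
pose proof (contr (x n) L (in_ball n) L_in_ball) as step.
change (T (x n)) with (x (S n)) in step.
pose proof (norm_dist_ge_0 (x n) L); nra.
Qed.

Lemma approx_linear_onto (f : C -> C) (a k v : C) (r eps : R) :
  0 <= eps < Cmod k -> approx_linear_on f a r k eps ->
  Cmod (v - f a)%C <= (Cmod k - eps) * r ->
  exists z, Cmod (z - a)%C <= r /\ f z = v.
Proof.
intros Heps f_approx Hv.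
assert (k_gt0 : 0 < Cmod k) by lra.
assert (k_neq0 : k <> 0) by now apply Cmod_gt_0.
(* The simplified Newton map [z - (f z - v) / k] contracts by the factor [eps / |k|]. *)
destruct (contraction_fixed_point (V := C_CompleteNormedModule)
  (fun z => (z - (f z - v) / k)%C) a (eps / Cmod k) r) as [z [Hz fixed]].
- split; [apply Rdiv_le_0_compat; lra|].
  apply Rmult_lt_reg_r with (Cmod k); [exact k_gt0|].
  unfold Rdiv; rewrite Rmult_assoc, Rinv_l by lra; lra.
- intros z w Hz Hw; specialize (f_approx z w Hz Hw).
  change (Cmod (z - (f z - v) / k - (w - (f w - v) / k))%C
          <= eps / Cmod k * Cmod (z - w)%C).
  replace (z - (f z - v) / k - (w - (f w - v) / k))%C
    with (- ((f z - f w - (z - w) * k) / k))%C by (field; exact k_neq0).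
  rewrite Cmod_opp, Cmod_div by exact k_neq0.
  replace (eps / Cmod k * Cmod (z - w)%C) with (eps * Cmod (z - w)%C / Cmod k)
    by (field; lra).
  apply Rmult_le_compat_r; [left; now apply Rinv_0_lt_compat | exact f_approx].
- change (Cmod (a - (f a - v) / k - a)%C <= (1 - eps / Cmod k) * r).
  replace (a - (f a - v) / k - a)%C with ((v - f a) / k)%C by (field; exact k_neq0).
  rewrite Cmod_div by exact k_neq0.
  replace ((1 - eps / Cmod k) * r) with ((Cmod k - eps) * r / Cmod k) by (field; lra).
  apply Rmult_le_compat_r; [left; now apply Rinv_0_lt_compat | exact Hv].
- exists z; split; [exact Hz|].
  replace (f z) with (v + (z - (z - (f z - v) / k)) * k)%C by (field; exact k_neq0).
  rewrite fixed; ring.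
Qed.

(* A single parameter [d] measures the domain, the expansion, the Lipschitz constant and
   the range, so that the property is inherited by smaller scales and can be made uniform
   over a compact set.  The radius [3 * d] leaves room to compare preimages chosen near
   two points at distance [d]. *)
Record invertible_at_scale (f : C -> C) (d : R) (a : C) : Prop := {
  scale_expanding : forall z w, Cmod (z - a)%C <= 3 * d -> Cmod (w - a)%C <= 3 * d ->
    d * Cmod (z - w)%C <= Cmod (f z - f w)%C;
  scale_lipschitz : forall z w, Cmod (z - a)%C <= 3 * d -> Cmod (w - a)%C <= 3 * d ->
    Cmod (f z - f w)%C <= / d * Cmod (z - w)%C;
  scale_onto : forall v, Cmod (v - f a)%C <= d ^ 2 ->
    exists z, Cmod (z - a)%C <= d /\ f z = v }.

Arguments scale_expanding {f d a}.
Arguments scale_lipschitz {f d a}.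
Arguments scale_onto {f d a}.

Lemma invertible_at_scale_inj (f : C -> C) (d : R) (a z w : C) :
  0 < d -> invertible_at_scale f d a ->
  Cmod (z - a)%C <= 3 * d -> Cmod (w - a)%C <= 3 * d -> f z = f w -> z = w.
Proof.
intros Hd Hf Hz Hw E; apply Cmod_minus_eq_0.
pose proof (scale_expanding Hf z w Hz Hw) as expand.
rewrite E, Cmod_minus_diag in expand; pose proof (Cmod_ge_0 (z - w)%C); nra.
Qed.

Lemma invertible_at_scale_le (f : C -> C) (d d' : R) (a : C) :
  0 < d' <= d -> invertible_at_scale f d a -> invertible_at_scale f d' a.
Proof.
intros Hd Hf; split.
- intros z w Hz Hw; pose proof (Cmod_ge_0 (z - w)%C).
  eapply Rle_trans; [|apply (scale_expanding Hf); lra]; nra.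
- intros z w Hz Hw; eapply Rle_trans; [apply (scale_lipschitz Hf); lra|].
  apply Rmult_le_compat_r; [apply Cmod_ge_0 | apply Rinv_le_contravar; lra].
- intros v Hv; destruct (scale_onto Hf v) as [z [Hz E]]; [nra|].
  exists z; split; [|exact E].
  pose proof (scale_expanding Hf z a) as expand.
  rewrite E, Cmod_minus_diag in expand.
  specialize (expand ltac:(lra) ltac:(lra)); nra.
Qed.

Lemma invertible_at_scale_of_approx_linear (f : C -> C) (a k : C) (d : R) :
  0 < d -> 2 * d <= Cmod k -> 2 * Cmod k <= / d ->
  approx_linear_on f a (3 * d) k (Cmod k / 2) -> invertible_at_scale f d a.
Proof.
intros d_gt0 d_le k_le f_approx; split.
- intros z w Hz Hw; pose proof (Cmod_ge_0 (z - w)%C).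
  pose proof (approx_linear_expanding f a k z w _ _ f_approx Hz Hw); nra.
- intros z w Hz Hw; pose proof (Cmod_ge_0 (z - w)%C).
  pose proof (approx_linear_lipschitz f a k z w _ _ f_approx Hz Hw); nra.
- intros v Hv; apply (approx_linear_onto f a k v d (Cmod k / 2)); [lra | | nra].
  apply (approx_linear_on_subball f a a k (3 * d)); [|exact f_approx].
  rewrite Cmod_minus_diag; lra.
Qed.

Lemma invertible_at_scale_near (f f' : C -> C) (p : C) :
  locally p (fun z => is_derive f z (f' z)) -> continuous f' p -> f' p <> 0 ->
  exists d, 0 < d /\ forall a, Cmod (a - p)%C < d -> invertible_at_scale f d a.
Proof.
intros f_deriv f'_cont f'_neq0; set (k := f' p) in *.
assert (k_gt0 : 0 < Cmod k) by now apply Cmod_gt_0.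
assert (half_k_gt0 : 0 < Cmod k / 2) by lra.
assert (near : locally p (fun z =>
  is_derive f z (f' z) /\ Cmod (f' z - k)%C < Cmod k / 2)).
{ apply filter_and; [exact f_deriv|].
  exact (proj1 (continuous_C_ball f' p) f'_cont (mkposreal _ half_k_gt0)). }
destruct (proj1 (locally_C_ball p _) near) as [e He]; pose proof (cond_pos e) as e_gt0.
assert (f_approx : approx_linear_on f p (e / 2) k (Cmod k / 2)).
{ apply (approx_linear_on_ball f f'); intros a Ha.
  destruct (He a) as [deriv close]; [lra | split; [exact deriv | lra]]. }
set (d := Rmin (e / 8) (Rmin (Cmod k / 2) (/ (2 * Cmod k)))).
assert (d_le : d <= e / 8 /\ d <= Cmod k / 2 /\ d <= / (2 * Cmod k)).
{ unfold d; repeat split; [apply Rmin_l | |];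
    (eapply Rle_trans; [apply Rmin_r | apply Rmin_l || apply Rmin_r]). }
assert (d_gt0 : 0 < d).
{ unfold d; repeat apply Rmin_glb_lt; try lra; apply Rinv_0_lt_compat; lra. }
exists d; split; [exact d_gt0|]; intros a Ha.
apply (invertible_at_scale_of_approx_linear f a k d); [exact d_gt0 | lra | |].
- rewrite <- (Rinv_inv (2 * Cmod k)); apply Rinv_le_contravar; lra.
- apply (approx_linear_on_subball f p a k (e / 2)); [lra | exact f_approx].
Qed.

Lemma closed_disk_uniform_scale (rho : R) (P : R -> C -> Prop) :
  (forall a d d', 0 < d' <= d -> P d a -> P d' a) ->
  (forall p, Cmod p <= rho -> exists d, 0 < d /\ forall a, Cmod (a - p)%C < d -> P d a) ->
  exists d, 0 < d /\ forall a, Cmod a <= rho -> P d a.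
Proof.
intros P_mono P_local.
assert (cover : forall p : R * R, exists d : posreal, forall a,
  Cmod a <= rho -> Cmod (a - p)%C < 2 * d -> P d a).
{ intros p; destruct (Rle_lt_dec (Cmod p) rho) as [Hp | Hp].
  - destruct (P_local p Hp) as [d [Hd K]].
    exists (mkposreal _ (is_pos_div_2 (mkposreal d Hd))); cbn; intros a _ Ha.
    apply (P_mono a d); [lra | apply K; lra].
  - assert (Hd : 0 < (Cmod p - rho) / 2) by lra.
    exists (mkposreal _ Hd); cbn; intros a Ha Hpa; exfalso.
    rewrite Cmod_minus_sym in Hpa; pose proof (Cmod_le_plus_minus p a); lra. }
destruct (functional_choice _ cover) as [delta Hdelta].
destruct (compactness_value_2d (- rho) rho (- rho) rho (fun x y => delta (x, y)))
  as [d Hd].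
exists d; split; [apply cond_pos|]; intros a Ha.
apply NNPP; intros notP; apply (Hd (Re a) (Im a)).
- pose proof (re_le_Cmod a); apply Rabs_le_between; lra.
- pose proof (im_le_Cmod a); apply Rabs_le_between; lra.
- intros (x & y & _ & _ & Hx & Hy & d_le); apply notP.
  apply (P_mono a (delta (x, y))); [split; [apply cond_pos | exact d_le]|].
  apply Hdelta; [exact Ha|].
  eapply Rle_lt_trans; [apply Cmod_le_re_im|].
  change (Rabs (Re a - x) + Rabs (Im a - y) < 2 * delta (x, y)); lra.
Qed.

Lemma lift_near (f : C -> C) (d : R) (g v : R -> C) :
  0 < d ->
  (forall t, continuous g t) -> (forall t, continuous v t) ->
  (forall t, invertible_at_scale f d (g t)) ->
  (forall t, Cmod (v t - f (g t))%C <= d ^ 2) ->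
  exists G, (forall t, continuous G t) /\
    forall t, Cmod (G t - g t)%C <= d /\ f (G t) = v t.
Proof.
intros d_gt0 g_cont v_cont f_inv v_near.
destruct (functional_choice _ (fun t => scale_onto (f_inv t) (v t) (v_near t)))
  as [G HG].
exists G; split; [|exact HG]; intros t.
apply continuous_C_ball; intros eps.
assert (deps_gt0 : 0 < d * eps) by (pose proof (cond_pos eps); nra).
generalize (filter_and _ _
  (proj1 (continuous_C_ball g t) (g_cont t) (mkposreal d d_gt0))
  (proj1 (continuous_C_ball v t) (v_cont t) (mkposreal _ deps_gt0))).
apply filter_imp; cbn; intros s [Hg Hv].
destruct (HG s) as [Gs Es]; destruct (HG t) as [Gt Et].
pose proof (Cmod_minus_triangle (G s) (g s) (g t)).
pose proof (scale_expanding (f_inv t) (G s) (G t) ltac:(lra) ltac:(lra)) as expand.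
rewrite Es, Et in expand.
apply Rmult_lt_reg_l with d; lra.
Qed.

(** * Lifting segments through a convex function *)

(* The values of [g] outside [[0, 1]] carry no information; requiring continuity on all
   of [R] makes it two-sided at 0 and 1. *)
Record segment_lift (f : C -> C) (r : R) (z0 z1 : C) (g : R -> C) : Prop := {
  lift_continuous : forall t, continuous g t;
  lift_start : g 0 = z0;
  lift_end : g 1 = z1;
  lift_bound : forall t, 0 <= t <= 1 -> Cmod (g t) <= r;
  lift_eq : forall t, 0 <= t <= 1 -> f (g t) = segment (f z0) (f z1) t }.

Arguments lift_continuous {f r z0 z1 g}.
Arguments lift_start {f r z0 z1 g}.
Arguments lift_end {f r z0 z1 g}.
Arguments lift_bound {f r z0 z1 g}.
Arguments lift_eq {f r z0 z1 g}.

Lemma segment_lift_const (f : C -> C) (r : R) (z : C) :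
  Cmod z <= r -> segment_lift f r z z (fun _ => z).
Proof.
intros Hz; split; trivial.
- intros t; apply continuous_const.
- intros t _; now rewrite segment_diag.
Qed.

Lemma segment_lift_extend (f : C -> C) (r d : R) (z0 z1 z2 : C) (g : R -> C) :
  0 < d -> (forall a, Cmod a <= r -> invertible_at_scale f d a) ->
  Cmod (z2 - z1)%C <= d -> Cmod (f z2 - f z1)%C <= d ^ 2 ->
  segment_lift f r z0 z1 g -> exists G, segment_lift f (r + d) z0 z2 G.
Proof.
intros d_gt0 f_inv z_near fz_near g_lift.
assert (g_inv : forall t, invertible_at_scale f d (g (clamp t)))
  by (intros t; apply f_inv, (lift_bound g_lift), clamp_range).
destruct (lift_near f d (fun t => g (clamp t))
  (fun t => segment (f z0) (f z2) (clamp t))) as [G [G_cont HG]]; trivial.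
- intros t; apply (continuous_comp clamp g);
    [apply continuous_clamp | apply (lift_continuous g_lift)].
- intros t; apply (continuous_comp clamp (segment (f z0) (f z2)));
    [apply continuous_clamp | apply continuous_segment].
- intros t; pose proof (clamp_range t) as Ht.
  rewrite (lift_eq g_lift), segment_minus_end by exact Ht.
  rewrite Cmod_mult, Cmod_R, Rabs_pos_eq by lra.
  nra.
- assert (G_near : forall t, 0 <= t <= 1 ->
    Cmod (G t - g t)%C <= d /\ f (G t) = segment (f z0) (f z2) t)
    by (intros t Ht; rewrite <- (clamp_id t Ht) at 2 4; apply HG).
  exists G; split; trivial.
  + destruct (G_near 0) as [near E]; [lra|].
    rewrite (lift_start g_lift) in near; rewrite segment_0 in E.
    apply (invertible_at_scale_inj f d z0); trivial; try lra.
    * rewrite <- (lift_start g_lift); apply f_inv, (lift_bound g_lift); lra.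
    * rewrite Cmod_minus_diag; lra.
  + destruct (G_near 1) as [near E]; [lra|].
    rewrite (lift_end g_lift) in near; rewrite segment_1 in E.
    apply (invertible_at_scale_inj f d z1); trivial; try lra.
    rewrite <- (lift_end g_lift); apply f_inv, (lift_bound g_lift); lra.
  + intros t Ht; destruct (G_near t Ht) as [near _].
    pose proof (lift_bound g_lift t Ht).
    pose proof (Cmod_le_plus_minus (G t) (g t)); lra.
  + intros t Ht; now apply G_near.
Qed.

Section ConvexFunction.

Variables h h1 h2 : C -> C.
Hypothesis h_deriv : has_cderiv_on_disk h h1.
Hypothesis h1_deriv : has_cderiv_on_disk h1 h2.
Hypothesis h1_neq0 : forall z, unit_disk z -> h1 z <> 0.
Hypothesis h_convex : forall z, unit_disk z -> 0 <= Re (1 + z * h2 z / h1 z)%C.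

Lemma is_derive_id_mult_h1 (z : C) :
  unit_disk z -> is_derive (fun w => w * h1 w)%C z (1 * h1 z + z * h2 z)%C.
Proof.
intros Hz; apply (is_derive_C_mult (fun w => w));
  [apply is_derive_C_id | now apply h1_deriv].
Qed.

Section AlongLift.

Variables (r : R) (z0 z1 : C) (g : R -> C).
Hypothesis r_lt1 : r < 1.
Hypothesis g_lift : segment_lift h r z0 z1 g.

Let c := (h z1 - h z0)%C.
Let sqr_mod (t : R) := Cmod (g t) ^ 2.
Let radial (t : R) := Re (Cconj c * (g t * h1 (g t)))%C.
Let radial' (t : R) := Cmod c ^ 2 * Re (1 + g t * h2 (g t) / h1 (g t))%C.
Let height (t : R) := Re (Cconj c * u_of h h1 (g t))%C.

Lemma lift_in_disk (t : R) : 0 <= t <= 1 -> unit_disk (g t).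
Proof.
intros Ht; pose proof (lift_bound g_lift t Ht).
unfold unit_disk, in_disk; lra.
Qed.

Lemma is_derive_lift (t : R) : 0 < t < 1 -> is_derive g t (c / h1 (g t))%C.
Proof.
intros Ht; assert (g_in : unit_disk (g t)) by (apply lift_in_disk; lra).
apply (is_derive_of_comp_C h).
- apply (lift_continuous g_lift).
- now apply h_deriv.
- now apply h1_neq0.
- apply (is_derive_ext_loc (segment (h z0) (h z1))); [|apply is_derive_segment].
  apply (locally_interval _ t 0 1); cbn; try lra.
  intros s Hs0 Hs1; symmetry; apply (lift_eq g_lift); lra.
Qed.

Lemma is_derive_sqr_mod_lift (t : R) :
  0 < t < 1 -> is_derive sqr_mod t (2 * radial t / Cmod (h1 (g t)) ^ 2).
Proof.
intros Ht; assert (k_neq0 : h1 (g t) <> 0) by (apply h1_neq0, lift_in_disk; lra).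
replace (2 * radial t / Cmod (h1 (g t)) ^ 2)
  with (2 * Re (Cconj (g t) * (c / h1 (g t)))%C).
- apply is_derive_Cmod_sqr, is_derive_lift, Ht.
- assert (sqr_neq0 : Cmod (h1 (g t)) ^ 2 <> 0)
    by now apply Rgt_not_eq, pow_lt, Cmod_gt_0.
  revert sqr_neq0; unfold radial; rewrite Cmod2_alt.
  destruct c, (g t), (h1 (g t)); unfold Re, Im, Cconj; simpl; intros; field; lra.
Qed.

Lemma is_derive_radial_lift (t : R) : 0 < t < 1 -> is_derive radial t (radial' t).
Proof.
intros Ht; assert (g_in : unit_disk (g t)) by (apply lift_in_disk; lra).
replace (radial' t)
  with (Re (Cconj c * (c / h1 (g t) * (1 * h1 (g t) + g t * h2 (g t))))%C).
- apply is_derive_re_mult, (is_derive_comp_C (fun z => z * h1 z)%C).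
  + now apply is_derive_id_mult_h1.
  + now apply is_derive_lift.
- unfold radial'; rewrite <- re_scal_l, Cmod2_conj; f_equal; field; now apply h1_neq0.
Qed.

Lemma continuous_sqr_mod_lift (t : R) : continuous sqr_mod t.
Proof. apply continuous_Cmod_sqr, (lift_continuous g_lift). Qed.

Lemma continuous_radial_lift (t : R) : 0 <= t <= 1 -> continuous radial t.
Proof.
intros Ht; apply continuous_re_mult.
apply (continuous_comp g (fun z => z * h1 z)%C).
- apply (lift_continuous g_lift).
- eapply is_derive_C_continuous, is_derive_id_mult_h1, lift_in_disk, Ht.
Qed.

Lemma radial'_ge0 (t : R) : 0 <= t <= 1 -> 0 <= radial' t.
Proof.
intros Ht; apply Rmult_le_pos; [apply pow2_ge_0 | now apply h_convex, lift_in_disk].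
Qed.

Lemma radial_lift_nondecreasing (s t : R) :
  0 <= s -> s <= t -> t <= 1 -> radial s <= radial t.
Proof.
intros Hs [Hst | <-] Ht; [|lra].
destruct (MVT_is_derive radial radial' s t Hst) as [x [Hx E]].
- intros x Hx; apply is_derive_radial_lift; lra.
- intros x Hx; apply continuous_radial_lift; lra.
- pose proof (radial'_ge0 x ltac:(lra)); nra.
Qed.

Lemma sqr_mod_lift_le (t : R) :
  0 <= t <= 1 -> sqr_mod t <= Rmax (Cmod z0 ^ 2) (Cmod z1 ^ 2).
Proof.
rewrite <- (lift_start g_lift), <- (lift_end g_lift).
assert (inv_sqr_gt0 : forall s, 0 <= s <= 1 -> 0 < / Cmod (h1 (g s)) ^ 2)
  by (intros s Hs; now apply Rinv_0_lt_compat, pow_lt, Cmod_gt_0, h1_neq0, lift_in_disk).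
apply (le_Rmax_of_derive_sign sqr_mod (fun s => 2 * radial s / Cmod (h1 (g s)) ^ 2)).
- exact is_derive_sqr_mod_lift.
- intros s _; apply continuous_sqr_mod_lift.
- intros x y Hx Hxy Hy; unfold Rdiv; intros rising.
  pose proof (inv_sqr_gt0 x ltac:(lra)) as x_pos; pose proof (inv_sqr_gt0 y ltac:(lra)).
  assert (radial_gt0 : 0 < radial x) by (apply (Rmult_lt_reg_r _ _ _ x_pos); lra).
  pose proof (radial_lift_nondecreasing x y ltac:(lra) Hxy ltac:(lra)).
  apply Rmult_le_pos; lra.
Qed.

Lemma segment_lift_shrink (rho : R) :
  Cmod z0 <= rho -> Cmod z1 <= rho -> segment_lift h rho z0 z1 g.
Proof.
intros Hz0 Hz1; destruct g_lift; split; trivial.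
intros t Ht.
assert (sqr_le : Cmod (g t) ^ 2 <= rho ^ 2).
{ eapply Rle_trans; [now apply sqr_mod_lift_le|].
  apply Rmax_lub; apply pow_incr; split; trivial; apply Cmod_ge_0. }
pose proof (Cmod_ge_0 z0); nra.
Qed.

Lemma lift_ends_eq : c = 0 -> z1 = z0.
Proof.
intros c_eq0.
pose proof (Cmod_increment_le g (fun t => c / h1 (g t))%C 0 1 0 Rlt_0_1) as increment.
rewrite (lift_start g_lift), (lift_end g_lift) in increment.
apply Cmod_minus_eq_0, Rle_antisym; [|apply Cmod_ge_0].
rewrite <- (Rmult_0_l (1 - 0)); apply increment.
- exact is_derive_lift.
- intros t _; apply (lift_continuous g_lift).
- intros t _; right; rewrite c_eq0; unfold Cdiv; rewrite Cmult_0_l; apply Cmod_0.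
Qed.

Lemma radial_sqr_le (t : R) :
  radial t ^ 2 <= Cmod c ^ 2 * sqr_mod t * Cmod (h1 (g t)) ^ 2.
Proof.
unfold sqr_mod; rewrite <- !Rpow_mult_distr, <- pow2_abs.
apply pow_incr; split; [apply Rabs_pos|].
eapply Rle_trans; [apply re_le_Cmod|].
rewrite !Cmod_mult, Cmod_conj; lra.
Qed.

Lemma heightE (t : R) :
  height t = Re (Cconj c * h (g t))%C + 1 / 2 * ((1 - sqr_mod t) * radial t).
Proof.
unfold height, u_of, radial, sqr_mod; rewrite Cmult_plus_distr_l, re_plus.
rewrite <- Rmult_assoc, <- re_scal_l; f_equal; f_equal; ring.
Qed.

Lemma is_derive_height (t : R) :
  0 < t < 1 ->
  is_derive height t
    (Cmod c ^ 2 + 1 / 2 * ((1 - sqr_mod t) * radial' t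
      - 2 * radial t / Cmod (h1 (g t)) ^ 2 * radial t)).
Proof.
intros Ht; assert (g_in : unit_disk (g t)) by (apply lift_in_disk; lra).
eapply is_derive_ext; [intros s; symmetry; apply heightE|].
assert (h_part : is_derive (fun s => Re (Cconj c * h (g s))%C) t (Cmod c ^ 2)).
{ replace (Cmod c ^ 2) with (Re (Cconj c * (c / h1 (g t) * h1 (g t)))%C).
  - apply is_derive_re_mult, is_derive_comp_C;
      [now apply h_deriv | now apply is_derive_lift].
  - rewrite <- re_conj_mult_self; f_equal; field; now apply h1_neq0. }
assert (one_minus : is_derive (fun s => 1 - sqr_mod s) t
  (0 - 2 * radial t / Cmod (h1 (g t)) ^ 2)).
{ apply (is_derive_minus (fun _ => 1) sqr_mod);
    [apply (is_derive_const (V := R_NormedModule)) | now apply is_derive_sqr_mod_lift]. }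
evar_last.
- apply (is_derive_plus (fun s => Re (Cconj c * h (g s))%C)
    (fun s => 1 / 2 * ((1 - sqr_mod s) * radial s))); [exact h_part|].
  apply is_derive_scal.
  exact (is_derive_mult (K := R_AbsRing) _ radial t _ _ one_minus
    (is_derive_radial_lift t Ht) Rmult_comm).
- unfold plus, mult; simpl; unfold mult; simpl; ring.
Qed.

Lemma continuous_height (t : R) : 0 <= t <= 1 -> continuous height t.
Proof.
intros Ht.
apply (continuous_ext
  (fun s => Re (Cconj c * h (g s))%C + 1 / 2 * ((1 - sqr_mod s) * radial s))).
{ intros s; symmetry; apply heightE. }
apply (continuous_plus (V := R_NormedModule)).
- apply continuous_re_mult, (continuous_comp g h).
  + apply (lift_continuous g_lift).
  + eapply is_derive_C_continuous, h_deriv, lift_in_disk, Ht.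
- apply (continuous_mult (K := R_AbsRing)); [apply continuous_const|].
  apply (continuous_mult (K := R_AbsRing)); [|now apply continuous_radial_lift].
  apply (continuous_minus (V := R_NormedModule));
    [apply continuous_const | apply continuous_sqr_mod_lift].
Qed.

Lemma u_of_separates : c <> 0 -> u_of h h1 z0 <> u_of h h1 z1.
Proof.
intros c_neq0 u_eq.
destruct (MVT_is_derive _ _ 0 1 Rlt_0_1 is_derive_height continuous_height)
  as [t [Ht mean]].
unfold height in mean; rewrite (lift_start g_lift), (lift_end g_lift), u_eq in mean.
assert (g_in : unit_disk (g t)) by (apply lift_in_disk; lra).
assert (c_sqr_gt0 : 0 < Cmod c ^ 2) by now apply pow_lt, Cmod_gt_0.
assert (k_sqr_gt0 : 0 < Cmod (h1 (g t)) ^ 2) by now apply pow_lt, Cmod_gt_0, h1_neq0.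
assert (sqr_mod_lt1 : sqr_mod t < 1).
{ unfold sqr_mod; pose proof (Cmod_ge_0 (g t)); unfold unit_disk, in_disk in g_in; nra. }
pose proof (radial'_ge0 t ltac:(lra)).
assert (loss : 2 * radial t / Cmod (h1 (g t)) ^ 2 * radial t
               <= 2 * (Cmod c ^ 2 * sqr_mod t)).
{ apply Rmult_le_reg_l with (Cmod (h1 (g t)) ^ 2); [exact k_sqr_gt0|].
  replace (Cmod (h1 (g t)) ^ 2 * (2 * radial t / Cmod (h1 (g t)) ^ 2 * radial t))
    with (2 * radial t ^ 2) by (field; intros E; rewrite E in k_sqr_gt0; simpl in *; lra).
  pose proof (radial_sqr_le t); lra. }
nra.
Qed.

End AlongLift.

Lemma invertible_at_uniform_scale (rho : R) :
  rho < 1 ->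
  exists d, 0 < d < 1 - rho /\ forall a, Cmod a <= rho -> invertible_at_scale h d a.
Proof.
intros rho_lt1.
destruct (closed_disk_uniform_scale rho (invertible_at_scale h)) as [d [d_gt0 h_inv]].
- intros a d d'; apply invertible_at_scale_le.
- intros p Hp; assert (p_in : unit_disk p) by (unfold unit_disk, in_disk; lra).
  apply (invertible_at_scale_near h h1).
  + exact (filter_imp _ _ h_deriv (locally_in_disk 1 p p_in)).
  + now apply is_derive_C_continuous with (h2 p), h1_deriv.
  + now apply h1_neq0.
- exists (Rmin d ((1 - rho) / 2)).
  pose proof (Rmin_l d ((1 - rho) / 2)); pose proof (Rmin_r d ((1 - rho) / 2)).
  assert (0 < Rmin d ((1 - rho) / 2)) by (apply Rmin_glb_lt; lra).
  split; [lra|]; intros a Ha.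
  now apply (invertible_at_scale_le h d); [|apply h_inv].
Qed.

Lemma segment_lift_exists (rho : R) (z0 z1 : C) :
  rho < 1 -> Cmod z0 <= rho -> Cmod z1 <= rho -> exists g, segment_lift h rho z0 z1 g.
Proof.
intros rho_lt1 Hz0 Hz1.
destruct (invertible_at_uniform_scale rho rho_lt1) as [d [[d_gt0 d_lt] h_inv]].
set (e := Rmin d (d ^ 3) / (Cmod (z1 - z0)%C + 1)).
assert (d3_gt0 : 0 < d ^ 3) by now apply pow_lt.
pose proof (Cmod_ge_0 (z1 - z0)%C) as dist_ge0.
assert (e_gt0 : 0 < e) by (apply Rdiv_lt_0_compat; [now apply Rmin_glb_lt | lra]).
rewrite <- (segment_1 z0 z1).
apply (unit_interval_step_ind
  (fun s => exists g, segment_lift h rho z0 (segment z0 z1 s) g) e e_gt0).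
- rewrite segment_0; eexists; now apply segment_lift_const.
- intros s t Hs Ht Hst [g g_lift].
  set (z := segment z0 z1 s) in *; set (z' := segment z0 z1 t).
  assert (z_le : Cmod z <= rho) by now apply Cmod_segment_le.
  assert (z'_le : Cmod z' <= rho) by now apply Cmod_segment_le.
  assert (z_near : Cmod (z' - z)%C <= Rmin d (d ^ 3)).
  { unfold z, z'; rewrite segment_minus_param, Cmod_mult, Cmod_R.
    replace (Rmin d (d ^ 3)) with (e * (Cmod (z1 - z0)%C + 1)) by (unfold e; field; lra).
    apply Rmult_le_compat; trivial; [apply Rabs_pos | lra]. }
  pose proof (Rmin_l d (d ^ 3)); pose proof (Rmin_r d (d ^ 3)).
  destruct (segment_lift_extend h rho d z0 z z' g) as [G G_lift]; trivial; [lra| |].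
  + eapply Rle_trans; [apply (scale_lipschitz (h_inv z z_le))|].
    * lra.
    * rewrite Cmod_minus_diag; lra.
    * replace (d ^ 2) with (/ d * d ^ 3) by (field; lra).
      apply Rmult_le_compat_l; [left; now apply Rinv_0_lt_compat | lra].
  + exists G; apply (segment_lift_shrink (rho + d)); trivial; lra.
Qed.

Lemma u_of_univalent : univalent_on unit_disk (u_of h h1).
Proof.
intros z w Hz Hw u_eq.
destruct (segment_lift_exists (Rmax (Cmod z) (Cmod w)) z w) as [g g_lift].
- now apply Rmax_lub_lt.
- apply Rmax_l.
- apply Rmax_r.
- assert (radius_lt1 : Rmax (Cmod z) (Cmod w) < 1) by now apply Rmax_lub_lt.
  destruct (Ceq_dec (h w - h z)%C 0) as [h_eq | h_neq].
  + symmetry; now apply (lift_ends_eq _ z w g radius_lt1).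
  + now destruct (u_of_separates _ z w g radius_lt1 g_lift h_neq).
Qed.

End ConvexFunction.

Lemma radius_r_le_1 (alpha : R) : 0 <= alpha < 1 / 2 -> radius_r alpha <= 1.
Proof.
intros Ha; unfold radius_r.
assert (sqrt_le : sqrt ((1 - alpha) ^ 2 + 1 - 2 * alpha) <= 2 - 3 * alpha).
{ rewrite <- (sqrt_pow2 (2 - 3 * alpha)) by lra.
  apply sqrt_le_1_alt; nra. }
apply Rmult_le_reg_r with (1 - 2 * alpha); [lra|].
unfold Rdiv; rewrite Rmult_assoc, Rinv_l by lra; lra.
Qed.

Theorem theorem2 (alpha : R) (h h1 h2 : C -> C) :
  0 <= alpha < 1 ->
  normalized_analytic h h1 h2 ->
  convex_of_order alpha h1 h2 ->
  (1 / 2 <= alpha -> univalent_on unit_disk (u_of h h1)) /\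
  (alpha < 1 / 2 -> univalent_on (in_disk (radius_r alpha)) (u_of h h1)).
Proof.
intros Ha (h_deriv & h1_deriv & _ & _) (h1_neq0 & h_convex).
assert (u_univalent : univalent_on unit_disk (u_of h h1)).
{ apply (u_of_univalent h h1 h2); trivial.
  intros z Hz; specialize (h_convex z Hz); lra. }
split; [trivial|]; intros Ha2 z w Hz Hw.
pose proof (radius_r_le_1 alpha (conj (proj1 Ha) Ha2)) as radius_le.
apply u_univalent; unfold unit_disk, in_disk in *; lra.
Qed.
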